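(* Let $\{\mathcal{A},G,\sigma,\alpha\}$ be a $G$-crossed system. The center of $\mathcal{A}\rtimes_\alpha^\sigma G$ is $$Z(\mathcal{A}\rtimes_\alpha^\sigma G)=\Big\{\sum_{g\in G} r_g\,\overline{g}\in \mathcal{A}\rtimes_\alpha^\sigma G \;\Big|\; r_{ts^{-1}}\,\alpha(ts^{-1},s)=\sigma_s(r_{s^{-1}t})\,\alpha(s,s^{-1}t)\ \text{ and }\ r_s\,\sigma_s(a)=a\,r_s,\ \ \forall a\in\mathcal{A},\ (s,t)\in G\times G\Big\}.$$
   Context: A $G$-crossed system is a quadruple $\{\mathcal{A},G,\sigma,\alpha\}$ consisting of a unital associative ring $\mathcal{A}$ (not necessarily commutative), a group $G$ with unit $e$, a map $\sigma:G\to\mathrm{Aut}(\mathcal{A})$, $x\mapsto\sigma_x$, into the ring automorphisms of $\mathcal{A}$, and a map $\alpha:G\times G\to U(\mathcal{A})$ into the group of invertible elements of $\mathcal{A}$, such that for all $x,y,z\in G$, $a\in\mathcal{A}$: (i) $\sigma_x(\sigma_y(a))=\alpha(x,y)\,\sigma_{xy}(a)\,\alpha(x,y)^{-1}$; (ii) $\alpha(x,y)\,\alpha(xy,z)=\sigma_x(\alpha(y,z))\,\alpha(x,yz)$; (iii) $\alpha(x,e)=\alpha(e,x)=1_{\mathcal{A}}$. The crossed product $\mathcal{A}\rtimes_\alpha^\sigma G$ is the free left $\mathcal{A}$-module with basis $\{\overline{g}: g\in G\}$ (a copy of $G$), made into an associative unital ring by the biadditive multiplication determined by $(a_1\overline{x})(a_2\overline{y})=a_1\sigma_x(a_2)\,\alpha(x,y)\,\overline{xy}$.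 Its elements are formal sums $\sum_{g\in G}a_g\overline{g}$ with $a_g\in\mathcal{A}$, all but finitely many zero. *)

(* Defs.v *)
From HB Require Import structures.
From mathcomp Require Import all_boot all_algebra finmap.
From mathcomp.multinomials Require Import monalg.

Set Implicit Arguments.
Unset Strict Implicit.
Unset Printing Implicit Defensive.

Import GRing.Theory.

Local Open Scope fset_scope.
Local Open Scope ring_scope.

(* [pzRingType] rather than [nzRingType]: the zero ring is allowed. The map
   into U(A) is given by [cs_alpha] and its pointwise two-sided inverse
   [cs_alphaV], as [unitRingType] excludes the zero ring and assumes a decidable
   unit predicate; [cs_alphaV] is determined by [cs_alpha]. *)
Record crossed_system (A : pzRingType) (G : groupType) := CrossedSystem {
  cs_sigma : G -> {rmorphism A -> A};
  cs_sigma_bij : forall x : G, bijective (cs_sigma x);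
  cs_alpha : G -> G -> A;
  cs_alphaV : G -> G -> A;
  cs_alphaVr : forall x y : G, cs_alpha x y * cs_alphaV x y = 1;
  cs_alphaVl : forall x y : G, cs_alphaV x y * cs_alpha x y = 1;
  cs_sigmaM : forall (x y : G) (a : A),
    cs_sigma x (cs_sigma y a)
      = cs_alpha x y * cs_sigma (x * y)%g a * cs_alphaV x y;
  cs_alphaM : forall x y z : G,
    cs_alpha x y * cs_alpha (x * y)%g z
      = cs_sigma x (cs_alpha y z) * cs_alpha x (y * z)%g;
  cs_alphax1 : forall x : G, cs_alpha x 1%g = 1;
  cs_alpha1x : forall x : G, cs_alpha 1%g x = 1
}.

Section CrossedProductOps.

Context (A : pzRingType) (G : groupType) (S : crossed_system A G).

Local Notation sigma := (cs_sigma S).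
Local Notation alpha := (cs_alpha S).
Local Notation M := {malg A[G]}.

Lemma cs_sigma1 (a : A) : sigma 1%g a = a.
Proof.
apply: (bij_inj (cs_sigma_bij S 1%g)).
have h := cs_sigmaM S 1%g 1%g a.
have e := cs_alphaVr S 1%g 1%g; rewrite cs_alphax1 mul1r in e.
by rewrite h mulg1 cs_alphax1 e mul1r mulr1.
Qed.

(* [<< a *g x >>] is the element a * \overline{x}, and [u@_x] is the
   coefficient of u at \overline{x}. *)
Definition cpmul_term (u v : M) (x y : G) : M :=
  << u@_x * sigma x v@_y * alpha x y *g (x * y)%g >>.

Definition cpmul (u v : M) : M :=
  \sum_(x <- msupp u) \sum_(y <- msupp v) cpmul_term u v x y.

Definition cpone : M := << 1 *g 1%g >>.

Lemma cpmulw (d1 d2 : {fset G}) (u v : M) :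
  msupp u `<=` d1 -> msupp v `<=` d2 ->
  cpmul u v = \sum_(x <- d1) \sum_(y <- d2) cpmul_term u v x y.
Proof.
move=> le1 le2; rewrite /cpmul (big_fset_incl _ le1) /=.
  apply/eq_bigr=> x _; apply/big_fset_incl => // y _ /mcoeff_outdom vy.
  by rewrite /cpmul_term vy rmorph0 mulr0 mul0r monalgU0.
move=> x _ /mcoeff_outdom ux; rewrite big1 // => y _.
by rewrite /cpmul_term ux !mul0r monalgU0.
Qed.

Lemma cpmul0l : left_zero 0 cpmul.
Proof. by move=> u; rewrite /cpmul msupp0 big_seq_fset0. Qed.

Lemma cpmul0r : right_zero 0 cpmul.
Proof. by move=> u; rewrite /cpmul big1 // => x _; rewrite msupp0 big_seq_fset0. Qed.

Lemma cpmulUU (a b : A) (x y : G) :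
  cpmul << a *g x >> << b *g y >> = << a * sigma x b * alpha x y *g (x * y)%g >>.
Proof.
by rewrite (cpmulw msuppU_le msuppU_le) !big_seq_fset1 /cpmul_term !mcoeffUU.
Qed.

Lemma cpmulDl : left_distributive cpmul +%R.
Proof.
move=> u v w; rewrite (cpmulw (msuppD_le u v) (fsubset_refl _)).
rewrite (cpmulw (fsubsetUl _ (msupp v)) (fsubset_refl _)).
rewrite (cpmulw (fsubsetUr (msupp u) _) (fsubset_refl _)).
rewrite -big_split; apply/eq_bigr=> x _; rewrite -big_split; apply/eq_bigr=> y _.
by rewrite /= /cpmul_term mcoeffD !mulrDl monalgUD.
Qed.

Lemma cpmulDr : right_distributive cpmul +%R.
Proof.
move=> w u v; rewrite (cpmulw (fsubset_refl _) (msuppD_le u v)).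
rewrite (cpmulw (fsubset_refl _) (fsubsetUl _ (msupp v))).
rewrite (cpmulw (fsubset_refl _) (fsubsetUr (msupp u) _)).
rewrite -big_split; apply/eq_bigr=> x _; rewrite -big_split; apply/eq_bigr=> y _.
by rewrite /= /cpmul_term mcoeffD rmorphD mulrDr mulrDl monalgUD.
Qed.

Lemma cpmul_suml (I : Type) (r : seq I) (F : I -> M) (u : M) :
  cpmul (\sum_(i <- r) F i) u = \sum_(i <- r) cpmul (F i) u.
Proof. exact: (big_morph (cpmul^~ u) (fun _ _ => cpmulDl _ _ _) (cpmul0l _)). Qed.

Lemma cpmul_sumr (I : Type) (r : seq I) (F : I -> M) (u : M) :
  cpmul u (\sum_(i <- r) F i) = \sum_(i <- r) cpmul u (F i).
Proof. exact: (big_morph (cpmul u) (fun _ _ => cpmulDr _ _ _) (cpmul0r _)). Qed.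

Lemma cpmul1l : left_id cpone cpmul.
Proof.
move=> u; rewrite [in LHS](monalgE u) cpmul_sumr [RHS]monalgE.
apply/eq_bigr=> x _.
by rewrite cpmulUU cs_sigma1 cs_alpha1x mul1r mulr1 mul1g.
Qed.

Lemma cpmul1r : right_id cpone cpmul.
Proof.
move=> u; rewrite [in LHS](monalgE u) cpmul_suml [RHS]monalgE.
apply/eq_bigr=> x _.
by rewrite cpmulUU rmorph1 cs_alphax1 !mulr1 mulg1.
Qed.

Lemma cpmulA : associative cpmul.
Proof.
move=> u v w; rewrite (monalgE u) !cpmul_suml; apply/eq_bigr=> x _.
rewrite (monalgE v) !(cpmul_suml, cpmul_sumr); apply/eq_bigr=> y _.
rewrite (monalgE w) !cpmul_sumr; apply/eq_bigr=> z _.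
rewrite !cpmulUU mulgA; congr << _ *g _ >>.
rewrite !rmorphM cs_sigmaM -!mulrA; congr (_ * (_ * _)).
by rewrite -cs_alphaM mulrA (mulrA (cs_alphaV S x y)) cs_alphaVl mul1r -mulrA.
Qed.

Definition cpscale (a : A) (u : M) : M :=
  \sum_(x <- msupp u) << a * u@_x *g x >>.

Lemma cpscaleE (a : A) (u : M) (x : G) : (cpscale a u)@_x = a * u@_x.
Proof.
rewrite {2}[u]monalgE !raddf_sum mulr_sumr.
by apply/eq_bigr=> /= y _; rewrite !mcoeffU mulrnAr.
Qed.

Lemma cpscaleA (a b : A) (u : M) : cpscale a (cpscale b u) = cpscale (a * b) u.
Proof. by apply/malgP=> x; rewrite !cpscaleE mulrA. Qed.

Lemma cpscale1 : left_id 1 cpscale.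
Proof. by move=> u; apply/malgP=> x; rewrite cpscaleE mul1r. Qed.

Lemma cpscaleDr : right_distributive cpscale +%R.
Proof. by move=> a u v; apply/malgP=> x; rewrite !(mcoeffD, cpscaleE) mulrDr. Qed.

Lemma cpscaleDl (u : M) : {morph cpscale^~ u : a b / a + b}.
Proof. by move=> a b; apply/malgP=> x; rewrite !(mcoeffD, cpscaleE) mulrDl. Qed.

End CrossedProductOps.

Definition crossed_product (A : pzRingType) (G : groupType)
  (S : crossed_system A G) : Type := {malg A[G]}.

Section CrossedProductRing.

Context (A : pzRingType) (G : groupType) (S : crossed_system A G).

Local Notation sigma := (cs_sigma S).
Local Notation alpha := (cs_alpha S).

HB.instance Definition _ := GRing.Zmodule.copy (crossed_product S) {malg A[G]}.
HB.instance Definition _ := GRing.Zmodule_isPzRing.Build (crossed_product S)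
  (@cpmulA A G S) (@cpmul1l A G S) (@cpmul1r A G S) (@cpmulDl A G S)
  (@cpmulDr A G S).
HB.instance Definition _ := GRing.Zmodule_isLmodule.Build A (crossed_product S)
  (@cpscaleA A G) (@cpscale1 A G) (@cpscaleDr A G) (@cpscaleDl A G).

Definition cpbasis (x : G) : crossed_product S := << 1 *g x >>.

Lemma cpbasisE (u : crossed_product S) :
  u = \sum_(x <- msupp u) u@_x *: cpbasis x.
Proof.
rewrite {1}[u]monalgE; apply/eq_bigr=> x _; apply/malgP=> y.
by rewrite cpscaleE !mcoeffU mulrnAr mulr1.
Qed.

Lemma cpbasisM (a b : A) (x y : G) :
  (a *: cpbasis x) * (b *: cpbasis y)
    = (a * sigma x b * alpha x y) *: cpbasis (x * y)%g.
Proof.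
have scaleU (c : A) z : c *: cpbasis z = << c *g z >>.
  by apply/malgP=> t; rewrite cpscaleE !mcoeffU mulrnAr mulr1.
by rewrite !scaleU; exact: cpmulUU.
Qed.

End CrossedProductRing.

Definition in_center (R : pzRingType) (z : R) : Prop :=
  forall w : R, GRing.comm z w.

(* Main.v *)
Require Import Defs.
From HB Require Import structures.
From mathcomp Require Import all_boot all_algebra finmap.
From mathcomp.multinomials Require Import monalg.

Set Implicit Arguments.
Unset Strict Implicit.
Unset Printing Implicit Defensive.

Import GRing.Theory.

Local Open Scope ring_scope.

(** Multiplication is biadditive and every element is a sum of homogeneous
terms [b *: cpbasis S s], so [r] is central iff it commutes with each of those.
In a group, [x * s = t] has a unique solution in [x], and [s * y = t] a unique
one in [y]; hence multiplying [r] by a homogeneous term only twists and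
relocates its coefficients ([mcoeff_mulr_term], [mcoeff_mull_term]).  Commuting
with [b *: cpbasis S s] therefore means, for all [t],

  r_(t s^-1) sigma_(t s^-1)(b) alpha(t s^-1, s)
    = b sigma_s(r_(s^-1 t)) alpha(s, s^-1 t).

The case [b = 1] is the first condition of the theorem, and the case [s = 1]
is the second, since [sigma_1] is the
identity and [alpha] is 1 whenever one of its arguments is.  Conversely the
second condition moves [b] to the left of [r_(t s^-1)], after which the first
condition, multiplied on the left by [b], is exactly the displayed equation. *)

Section HomogeneousTerms.

Context (A : pzRingType) (G : groupType) (S : crossed_system A G).

Local Notation sigma := (cs_sigma S).
Local Notation alpha := (cs_alpha S).

Lemma scale_cpbasis (b : A) (s : G) : b *: cpbasis S s = << b *g s >>.
Proof. by apply/malgP => t; rewrite cpscaleE !mcoeffU mulrnAr mulr1. Qed.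

(** Right translation by [s] is a bijection of [G], so a single coefficient of
[u] contributes at [t]. *)
Lemma mcoeff_mulr_term (u : crossed_product S) (b : A) (s t : G) :
  (u * (b *: cpbasis S s))@_t
    = u@_(t * s^-1)%g * sigma (t * s^-1)%g b * alpha (t * s^-1)%g s.
Proof.
rewrite scale_cpbasis; set x0 := (t * s^-1)%g.
(* The index [x0] is added to the support so that it can be isolated in the sum
   whether or not its coefficient vanishes. *)
rewrite [_ * _](cpmulw S (fsubsetUr [fset x0]%fset (msupp u)) msuppU_le).
under eq_bigr => x _ do rewrite big_seq_fset1.
rewrite (bigD1_seq x0) ?fset_uniq ?inE ?eqxx //= mcoeffD raddf_sum /= big1.
  by rewrite /cpmul_term mcoeffUU mcoeffU mulgVK eqxx addr0.
move=> x /negPf x_neq; rewrite mcoeffU.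
by rewrite -(inj_eq (mulIg s^-1%g)) mulgK -/x0 x_neq.
Qed.

(** The mirror image, with left translation: here [sigma s] acts on the
coefficient of [u] instead of on the scalar [b]. *)
Lemma mcoeff_mull_term (u : crossed_product S) (b : A) (s t : G) :
  ((b *: cpbasis S s) * u)@_t
    = b * sigma s u@_(s^-1 * t)%g * alpha s (s^-1 * t)%g.
Proof.
rewrite scale_cpbasis; set y0 := (s^-1 * t)%g.
rewrite [_ * _](cpmulw S msuppU_le (fsubsetUr [fset y0]%fset (msupp u))).
rewrite big_seq_fset1.
rewrite (bigD1_seq y0) ?fset_uniq ?inE ?eqxx //= mcoeffD raddf_sum /= big1.
  by rewrite /cpmul_term mcoeffUU mcoeffU mulVKg eqxx addr0.
move=> y /negPf y_neq; rewrite mcoeffU.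
by rewrite -(inj_eq (mulgI s^-1%g)) mulKg -/y0 y_neq.
Qed.

Lemma in_center_terms (r : crossed_product S) :
  in_center r <-> forall (b : A) (s : G), GRing.comm r (b *: cpbasis S s).
Proof.
split=> [r_central b s | r_comm w]; first exact: r_central.
by rewrite (cpbasisE w); apply: commr_sum => s _; apply: r_comm.
Qed.

End HomogeneousTerms.

Theorem proposition3p1 (A : pzRingType) (G : groupType)
    (S : crossed_system A G) (r : crossed_product S) :
  in_center r <->
  (forall (a : A) (s t : G),
     r@_(t * s^-1)%g * cs_alpha S (t * s^-1)%g s
       = cs_sigma S s r@_(s^-1 * t)%g * cs_alpha S s (s^-1 * t)%g
     /\ r@_s * cs_sigma S s a = a * r@_s).
Proof.
rewrite in_center_terms; split=> [r_comm a s t | r_cond b s].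
  have coefE b x y := congr1 (mcoeff y) (r_comm b x).
  split.
    have := coefE 1 s t; rewrite mcoeff_mulr_term mcoeff_mull_term.
    by rewrite rmorph1 mulr1 mul1r.
  have := coefE a 1%g s; rewrite mcoeff_mulr_term mcoeff_mull_term.
  by rewrite invg1 mulg1 mul1g cs_alphax1 cs_alpha1x cs_sigma1 !mulr1.
apply/malgP => t; rewrite mcoeff_mulr_term mcoeff_mull_term.
have [_ ->] := r_cond b (t * s^-1)%g t.
by have [E _] := r_cond b s t; rewrite -!mulrA E.
Qed.
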